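(* Let $\omega=e^{2\pi i/6}$, choose a sign $\pm$, and let $r\in\mathbb C\setminus\{0,\omega^{\pm1}\}$. Let $\Psi^\pm_r:\mathsf{PGL}_2(\mathbb Z)\to\mathsf{PGL}_2(\mathbb C)$ be the homomorphism with $$\Psi^\pm_r(T)=\begin{bmatrix}r&1\\0&1\end{bmatrix},\quad \Psi^\pm_r(S)=\begin{bmatrix}1&r^{-1}\\ -r+\omega^{\pm1}&-1\end{bmatrix},\quad \Psi^\pm_r(V)=\begin{bmatrix}1&\frac{1+r^{-1}}{r-\omega^{\pm1}}\\ 1-r&-1\end{bmatrix}.$$ Then there exists $M\in\mathsf{PGL}_2(\mathbb C)$ with $M\,\Psi^\pm_r(g)\,M^{-1}=\alpha(g)$ for all $g\in\mathsf{PGL}_2(\mathbb Z)$ (equivalently $M\Psi^\pm_r(U)M^{-1}=U$, $M\Psi^\pm_r(K)M^{-1}=K$, $M\Psi^\pm_r(V)M^{-1}=UV$) if and only if $r=-\varphi^2$ or $r=-\bar\varphi^2$.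
   Context: $\varphi=\frac{1+\sqrt5}{2}$, $\bar\varphi=\frac{1-\sqrt5}{2}$. An invertible matrix $\begin{bmatrix}a&b\\c&d\end{bmatrix}$ denotes the Möbius map $x\mapsto(ax+b)/(cx+d)$. In $\mathsf{PGL}_2(\mathbb Z)$: $T(x)=1+x$, $S(x)=-1/x$, $U(x)=1/x$, $V(x)=-x$, $K(x)=1-x$; $T,S,V$ generate $\mathsf{PGL}_2(\mathbb Z)$. Dyer's outer automorphism $\alpha$ of $\mathsf{PGL}_2(\mathbb Z)$ is the involutive automorphism with $\alpha(U)=U$, $\alpha(K)=K$, $\alpha(V)=UV$ (so $\alpha(T)=TU$, $\alpha(S)=V$). *)

(* Defs.v *)
From HB Require Import structures.
From mathcomp Require Import all_boot all_order all_algebra.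
From mathcomp Require Import complex Rstruct.
From Stdlib Require Import Rdefinitions.
Set Implicit Arguments. Unset Strict Implicit. Unset Printing Implicit Defensive.
Import Order.TTheory GRing.Theory Num.Theory.
Local Open Scope ring_scope.

Notation CC := (Rdefinitions.R[i]).

Definition Cr (x : Rdefinitions.R) : CC := Complex x 0.

(* omega = e^{2 pi i / 6} = 1/2 + i sqrt(3)/2 *)
Definition omega : CC := Complex (1/2) (Num.sqrt 3 / 2).

Definition phi : CC := Cr ((1 + Num.sqrt 5) / 2).
Definition phibar : CC := Cr ((1 - Num.sqrt 5) / 2).

(* the 2x2 matrix [a b; c d], denoting x |-> (ax+b)/(cx+d) *)
Definition mx2 (a b c d : CC) : 'M[CC]_2 :=
  \matrix_(i < 2, j < 2)
     if (i : nat) == 0%N then (if (j : nat) == 0%N then a else b)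
     else (if (j : nat) == 0%N then c else d).

(* Equality in PGL_2(C): equality up to a nonzero scalar. *)
Definition proj_eq (A B : 'M[CC]_2) : Prop := exists c : CC, c != 0 /\ A = c *: B.

Definition matT : 'M[CC]_2 := mx2 1 1 0 1.
Definition matS : 'M[CC]_2 := mx2 0 (-1) 1 0.
Definition matV : 'M[CC]_2 := mx2 (-1) 0 0 1.
Definition matU : 'M[CC]_2 := mx2 0 1 1 0.
Definition matK : 'M[CC]_2 := mx2 (-1) 1 0 1.

(* The generators T, S, V of PGL_2(Z); every element of PGL_2(Z) is the
   value of a word in these generators (they generate PGL_2(Z) even as a
   monoid, since S, V have finite order and T^-1 = STSTS in PGL_2(Z)). *)
Inductive gen := gT | gS | gV.

Definition eval_word (f : gen -> 'M[CC]_2) (w : seq gen) : 'M[CC]_2 :=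
  foldr (fun g M => f g *m M) 1%:M w.

Definition gen_mx (g : gen) : 'M[CC]_2 :=
  match g with gT => matT | gS => matS | gV => matV end.

(* Dyer's automorphism alpha on generators: alpha(T) = TU, alpha(S) = V,
   alpha(V) = UV; alpha of a word is the product of the images. *)
Definition alpha_gen (g : gen) : 'M[CC]_2 :=
  match g with gT => matT *m matU | gS => matV | gV => matU *m matV end.

(* omega^{+1} or omega^{-1} according to the sign s (true = +) *)
Definition omega_s (s : bool) : CC := if s then omega else omega^-1.

Definition Psi_gen (s : bool) (r : CC) (g : gen) : 'M[CC]_2 :=
  match g with
  | gT => mx2 r 1 0 1
  | gS => mx2 1 r^-1 (- r + omega_s s) (-1)
  | gV => mx2 1 ((1 + r^-1) / (r - omega_s s)) (1 - r) (-1)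
  end.

(* Main.v *)
(* Conjugation in PGL_2 preserves the invariant tr^2 / det.  Since alpha(T) = TU
   has tr^2 / det = -1 while Psi(T) has (r + 1)^2 / r, a conjugating matrix
   forces r^2 + 3r + 1 = 0, whose roots are -phi^2 and -phibar^2.  Conversely,
   for such r one explicit matrix M conjugates the image of each generator to its
   alpha-image up to a scalar (a computation modulo omega^2 = omega - 1 and
   r^2 = -3r - 1), and conjugation up to scalars is multiplicative on words. *)

Require Import Defs.
From HB Require Import structures.
From mathcomp Require Import all_boot all_order all_algebra.
From mathcomp Require Import complex Rstruct ring.
Set Implicit Arguments. Unset Strict Implicit. Unset Printing Implicit Defensive.
Import Order.TTheory GRing.Theory Num.Theory.
Local Open Scope ring_scope.

Lemma mx2_mul a b c d e f g h :
  mx2 a b c d *m mx2 e f g h =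
  mx2 (a * e + b * g) (a * f + b * h) (c * e + d * g) (c * f + d * h).
Proof.
apply/matrixP => i j; rewrite !mxE !big_ord_recl big_ord0 !mxE /=.
by case: i => [[|[|i]] Hi] //; case: j => [[|[|j]] Hj] //=; rewrite addr0.
Qed.

Lemma scale_mx2 k a b c d : k *: mx2 a b c d = mx2 (k * a) (k * b) (k * c) (k * d).
Proof.
apply/matrixP => i j; rewrite !mxE.
by case: i => [[|[|i]] Hi] //; case: j => [[|[|j]] Hj].
Qed.

Lemma mx2_1 : 1%:M = mx2 1 0 0 1.
Proof.
apply/matrixP => i j; rewrite !mxE.
by case: i => [[|[|i]] Hi] //; case: j => [[|[|j]] Hj].
Qed.

Lemma mxtrace_mx2 a b c d : \tr (mx2 a b c d) = a + d.
Proof. by rewrite /mxtrace !big_ord_recl big_ord0 !mxE /= addr0. Qed.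

Lemma det_mx2 a b c d : \det (mx2 a b c d) = a * d - b * c.
Proof.
rewrite (expand_det_row _ ord0) !big_ord_recl big_ord0 /cofactor !mxE /=.
by rewrite !det_mx11 !mxE /= addr0 expr0 expr1 !mulNr !mul1r mulrN.
Qed.

Section Conjugation.
Variable M : 'M[CC]_2.
Hypothesis unitM : M \in unitmx.

Lemma mxtrace_conj A : \tr (M *m A *m invmx M) = \tr A.
Proof. by rewrite mxtrace_mulC mulKmx. Qed.

Lemma det_conj A : \det (M *m A *m invmx M) = \det A.
Proof.
have detM : \det M != 0 by rewrite -unitfE -unitmxE.
by rewrite !det_mulmx det_inv mulrAC divff // mul1r.
Qed.

Lemma conj_mulmx A B :
  M *m (A *m B) *m invmx M = (M *m A *m invmx M) *m (M *m B *m invmx M).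
Proof. by rewrite !mulmxA (mulmxKV unitM). Qed.

Lemma proj_eq_conj_intertwine (A B : 'M[CC]_2) (c : CC) :
  c != 0 -> M *m A = c *: (B *m M) -> proj_eq (M *m A *m invmx M) B.
Proof. by move=> c0 MA; exists c; rewrite MA -scalemxAl (mulmxK unitM). Qed.

End Conjugation.

Lemma proj_eq_trace_det A B :
  proj_eq A B -> \tr A ^+ 2 * \det B = \tr B ^+ 2 * \det A.
Proof. by case=> c [_ ->]; rewrite mxtraceZ detZ; ring. Qed.

Lemma proj_eq_mul A B C D :
  proj_eq A B -> proj_eq C D -> proj_eq (A *m C) (B *m D).
Proof.
case=> a [a0 ->] [c [c0 ->]]; exists (a * c); split; first exact: mulf_neq0.
by rewrite -scalemxAl -scalemxAr scalerA.
Qed.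

Lemma proj_eq_conj_eval_word (f g : gen -> 'M[CC]_2) M :
  M \in unitmx -> (forall x, proj_eq (M *m f x *m invmx M) (g x)) ->
  forall w, proj_eq (M *m eval_word f w *m invmx M) (eval_word g w).
Proof.
move=> unitM conjM; elim=> [|x w IHw] /=.
  by exists 1; rewrite mulmx1 mulmxV // scale1r oner_neq0.
by rewrite conj_mulmx //; apply: proj_eq_mul.
Qed.

Lemma eval_word1 f x : eval_word f [:: x] = f x.
Proof. by rewrite /eval_word /= mulmx1. Qed.

Lemma omega_s_sqr s : omega_s s ^+ 2 = omega_s s - 1.
Proof.
have omega_sqr : omega ^+ 2 = omega - 1.
  apply/eqP; rewrite expr2 eq_complex /=; apply/andP; split; apply/eqP.
  - have sqrt3 : Num.sqrt (3 : Rdefinitions.R) ^+ 2 = 3 by rewrite sqr_sqrtr ?ler0n.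
    by field: sqrt3.
  - by field.
case: s => //=; have omega0 : omega != 0.
  by apply: contra_eqN omega_sqr => /eqP->; rewrite expr2 mul0r sub0r eq_sym oppr_eq0 oner_eq0.
by field: omega_sqr.
Qed.

Lemma phi_phibar_factor r :
  (r + phi ^+ 2) * (r + phibar ^+ 2) = r ^+ 2 + 3 * r + 1.
Proof.
have sqrt5 : Num.sqrt (5 : Rdefinitions.R) ^+ 2 = 5 by rewrite sqr_sqrtr ?ler0n.
have sum_sqr : phi ^+ 2 + phibar ^+ 2 = 3.
  rewrite /phi /phibar /Cr -!(rmorphXn (@real_complex _)) -rmorphD /=.
  have -> : ((1 + Num.sqrt 5) / 2) ^+ 2 + ((1 - Num.sqrt 5) / 2) ^+ 2 = 3 :> Rdefinitions.R.
    by field: sqrt5.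
  by rewrite (rmorph_nat (@real_complex _)).
have prod_sqr : phi ^+ 2 * phibar ^+ 2 = 1.
  rewrite /phi /phibar /Cr -!(rmorphXn (@real_complex _)) -rmorphM /=.
  have -> : ((1 + Num.sqrt 5) / 2) ^+ 2 * ((1 - Num.sqrt 5) / 2) ^+ 2 = 1 :> Rdefinitions.R.
    by field: sqrt5.
  by rewrite (rmorph1 (@real_complex _)).
by rewrite -[3]sum_sqr -[in RHS]prod_sqr; ring.
Qed.

Lemma golden_quadratic_rootsP r :
  r ^+ 2 + 3 * r + 1 = 0 <-> r = - phi ^+ 2 \/ r = - phibar ^+ 2.
Proof.
rewrite -phi_phibar_factor; split.
  by move/eqP; rewrite mulf_eq0 => /orP[]; rewrite addr_eq0 => /eqP; [left|right].
by case=> ->; rewrite addNr ?mul0r ?mulr0.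
Qed.

Lemma conj_PsiT_quadratic s r M :
  M \in unitmx -> proj_eq (M *m Psi_gen s r gT *m invmx M) (alpha_gen gT) ->
  r ^+ 2 + 3 * r + 1 = 0.
Proof.
move=> unitM /proj_eq_trace_det.
rewrite mxtrace_conj // det_conj // /alpha_gen /matT /matU mx2_mul.
rewrite !mxtrace_mx2 !det_mx2 => /eqP; rewrite eq_sym -subr_eq0 => /eqP <-.
by ring.
Qed.

Section Conjugator.
Variables (s : bool) (r : CC).
Hypothesis quad_r : r ^+ 2 + 3 * r + 1 = 0.
Local Notation w := (omega_s s).

Let w_sqr : w ^+ 2 = w - 1. Proof. exact: omega_s_sqr. Qed.
Let r_sqr : r ^+ 2 = -3 * r - 1.
Proof. by rewrite -[LHS]subr0 -quad_r; ring. Qed.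

Let neq0_of_mul_eq1 (c d : CC) : c * d = 1 -> c != 0.
Proof. by move=> cd; rewrite -unitfE; apply/unitrPr; exists d. Qed.

Let r_neq0 : r != 0.
Proof. by apply: (@neq0_of_mul_eq1 _ (- r - 3)); ring: r_sqr. Qed.

Let r_inv : r^-1 = - r - 3.
Proof. by apply: (mulfI r_neq0); rewrite mulfV //; ring: r_sqr. Qed.

Let r_sub_w_inv : (r - w)^-1 = -1 - r / 4 + 3 * w / 4 + r * w / 4.
Proof.
have r_sub_w0 : r - w != 0.
  by apply: (@neq0_of_mul_eq1 _ (-1 - r / 4 + 3 * w / 4 + r * w / 4)); field: r_sqr w_sqr.
by apply: (mulfI r_sub_w0); rewrite mulfV //; field: r_sqr w_sqr.
Qed.

Definition conjugator : 'M[CC]_2 := mx2 (1 + r + r * w) w (-1 + w + r * w) 1.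

Lemma conjugator_unit : conjugator \in unitmx.
Proof.
have inv_conj : conjugator *m ((2 + 2 * r)^-1 *: mx2 1 (- w) (1 - w - r * w) (1 + r + r * w)) = 1%:M.
  have two_r_neq0 : 2 + 2 * r != 0.
    by apply: (@neq0_of_mul_eq1 _ ((r + 2) / 2)); field: r_sqr.
  by rewrite -scalemxAr mx2_mul scale_mx2 mx2_1; congr mx2; field: r_sqr w_sqr.
exact: (mulmx1_unit inv_conj).1.
Qed.

Lemma conjugator_intertwines x : exists2 c : CC, c != 0 &
  conjugator *m Psi_gen s r x = c *: (alpha_gen x *m conjugator).
Proof.
rewrite /alpha_gen /matT /matU /matV; case: x => /=.
- exists (r + 1); first by apply: (@neq0_of_mul_eq1 _ (r + 2)); ring: r_sqr.
  by rewrite !mx2_mul scale_mx2; congr mx2; ring: r_sqr w_sqr.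
- exists (- w ^+ 2 * (r + 2)); first by apply: (@neq0_of_mul_eq1 _ (w * (r + 1))); ring: r_sqr w_sqr.
  by rewrite r_inv !mx2_mul scale_mx2; congr mx2; ring: r_sqr w_sqr.
- exists (1 / 2 - 2 * w - r * w / 2).
    by apply: (@neq0_of_mul_eq1 _ (-1 / 2 + w / 2 - r * w / 2)); field: r_sqr w_sqr.
  by rewrite r_inv r_sub_w_inv !mx2_mul scale_mx2; congr mx2; field: r_sqr w_sqr.
Qed.

End Conjugator.

(* The hypotheses [r != 0] and [r != omega_s s] only make Psi well defined;
   they hold automatically on the roots of r^2 + 3r + 1. *)
Theorem mainTheorem12 (s : bool) (r : CC) :
  r != 0 -> r != omega_s s ->
  ((exists M : 'M[CC]_2, M \in unitmx /\
      forall w : seq gen,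
        proj_eq (M *m eval_word (Psi_gen s r) w *m invmx M)
                (eval_word alpha_gen w))
   <-> (r = - phi ^+ 2 \/ r = - phibar ^+ 2)).
Proof.
move=> _ _; split.
  case=> M [unitM conjM]; have := conjM [:: gT]; rewrite !eval_word1.
  by move/(conj_PsiT_quadratic unitM)/golden_quadratic_rootsP.
move/golden_quadratic_rootsP => quad_r; have unitM := conjugator_unit s quad_r.
exists (conjugator s r); split=> //; apply: proj_eq_conj_eval_word => // x.
have [c c0 intertwine] := conjugator_intertwines s quad_r x.
exact: (proj_eq_conj_intertwine unitM c0 intertwine).
Qed.
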